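(* Let $n \geq 3$, $m_i \geq 3$ for all $1 \leq i \leq n$, and $G = K_{m_1} \square \cdots \square K_{m_n}$. If $C \subseteq V(G)$ is a group identifying code in $G$, then $|J_C(u)| \neq 2$ for every $u \in V(G)$, and $|J_C(u)| \geq 3$ for every $u \in V(G) \setminus C$.
   Context: $G$ is the Hamming graph with vertex set $\mathbb{Z}_{m_1} \times \cdots \times \mathbb{Z}_{m_n}$, a group under componentwise modular addition, two vertices adjacent iff they differ in exactly one coordinate. For $C \subseteq V(G)$, $J_C(v) = N[v] \cap C$ with $N[v]$ the closed neighborhood. $C$ is an identifying code if the sets $J_C(v)$, $v \in V(G)$, are all nonempty and pairwise distinct; a group identifying code is an identifying code that is a subgroup of $V(G)$. *)

(* Defs.v *)
From HB Require Import structures.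
From mathcomp Require Import all_boot all_order all_fingroup all_algebra.

Set Implicit Arguments.
Unset Strict Implicit.
Unset Printing Implicit Defensive.

Section Codes.
Variables (T : finType) (e : rel T).

Definition closed_nbhd (v : T) : {set T} := [set u | (u == v) || e v u].

Definition codeJ (C : {set T}) (v : T) : {set T} := closed_nbhd v :&: C.

Definition identifying_code (C : {set T}) : Prop :=
  (forall v, codeJ C v != set0) /\ injective (codeJ C).

End Codes.

(* 'Z_k is the ring of integers mod k only for k > 1. The finGroupType
   structure on this type is the direct product of the additive groups: its
   law, written multiplicatively, is componentwise addition (see hammingM). *)
Definition hammingV (n : nat) (m : 'I_n -> nat) : finGroupType :=
  {dffun forall i : 'I_n, 'Z_(m i)}.

Definition hamming_adj (n : nat) (m : 'I_n -> nat) : rel (hammingV m) :=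
  fun u v => #|[set i | u i != v i]| == 1.

Definition group_identifying_code (n : nat) (m : 'I_n -> nat)
    (C : {set hammingV m}) : Prop :=
  group_set C /\ identifying_code (@hamming_adj n m) C.

Lemma hammingM (n : nat) (m : 'I_n -> nat) (u v : hammingV m) (i : 'I_n) :
  (u * v)%g i = (u i + v i)%R.
Proof. by rewrite ffunE. Qed.

(* Main.v *)
Require Import Defs.
From mathcomp Require Import all_boot all_order all_fingroup all_algebra.

(** Write the group additively. The closed neighborhood of [u] is [u + S], where
    [S] is the union of the coordinate axes: cyclic subgroups meeting pairwise
    in [0]. So [J (k + u) = k + J u] for [k] in [C], [J (- u) = - J u], and [S]
    is closed under multiples.

    If [J u = {a, b}], the reflection in [a + b] fixes [J u], so [2u = a + b]
    and [k := a - b] equals [2(a - u)]. Then [k + a - u = 3(a - u)] lies in [S],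
    so [k + a] lies in [J u]: it is [a] or [b]. In the latter case translation
    by [k] fixes [J u]; either way [k = 0] and [a = b].

    If [J u = {a}], translate to [a = 0]. The reflection in [0] gives [2u = 0],
    and [u = x g] for the generator [g] of some axis. Suppose [u <> 0]. As
    [2g <> 0], [g <> u], so [J g] contains some [c <> 0]. The multiple [x c]
    lies in [J (x g) = {0}], so [u = x (g - c)] is a nonzero point of the axis
    of [g - c], which is thus the axis of [g]. Then [c] lies on that axis, hence
    in [J u], a contradiction. *)

Set Implicit Arguments.
Unset Strict Implicit.
Unset Printing Implicit Defensive.

Import GRing.Theory.
Local Open Scope group_scope.

Definition expg_closed (gT : finGroupType) (S : {set gT}) : Prop :=
  forall x k, x \in S -> x ^+ k \in S.

Lemma expg_closedV (gT : finGroupType) (S : {set gT}) :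
  expg_closed S -> S^-1 = S.
Proof.
move=> SX; apply/setP => x; rewrite mem_invg.
by apply/idP/idP => /(SX _ #[x].-1); rewrite ?expgVn -invg_expg ?invgK.
Qed.

Lemma bigcup_expg_closed (gT : finGroupType) (I : finType)
    (A : I -> {group gT}) :
  expg_closed (\bigcup_i A i).
Proof.
by move=> x k /bigcupP[i _ Ax]; apply/bigcupP; exists i; rewrite ?groupX.
Qed.

Section CayleyCode.
Variables (gT : finGroupType) (e : rel gT) (S : {set gT}).
Hypothesis nbhdE : forall u, closed_nbhd e u = u *: S.
Variable C : {group gT}.
Local Notation J := (codeJ e C).
Implicit Types u v a b k : gT.

Lemma mem_codeJ u v : (v \in J u) = (u^-1 * v \in S) && (v \in C).
Proof. by rewrite inE nbhdE mem_lcoset. Qed.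

Lemma mem1_codeJ u : S^-1 = S -> (1 \in J u) = (u \in S).
Proof. by move=> SV; rewrite mem_codeJ mulg1 group1 andbT -mem_invg SV. Qed.

Lemma codeJM k u : k \in C -> J (k * u) = k *: J u.
Proof.
move=> Ck; apply/setP => v; rewrite mem_lcoset !mem_codeJ.
by rewrite invMg mulgA groupMl ?groupV.
Qed.

Hypothesis mulgC : forall x y : gT, x * y = y * x.

Lemma codeJV u : S^-1 = S -> J u^-1 = (J u)^-1.
Proof.
move=> SV; apply/setP => v; rewrite mem_invg !mem_codeJ groupV.
by rewrite -{1}SV mem_invg invMg mulgC invgK.
Qed.

Section ExpgClosed.
Hypothesis SX : expg_closed S.

Lemma codeJX u v p : v \in J u -> v ^+ p \in J (u ^+ p).
Proof.
rewrite !mem_codeJ => /andP[/(SX p) Suv Cv].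
by rewrite groupX // -expgVn -expgMn ?Suv //; exact: mulgC.
Qed.

Hypothesis J_inj : injective J.

Lemma codeJ_set2_sqr u a b : J u = [set a; b] -> u ^+ 2 = a * b.
Proof.
move=> Ju.
have /setIP[_ Ca] : a \in J u by rewrite Ju set21.
have /setIP[_ Cb] : b \in J u by rewrite Ju set22.
suff abu : a * b * u^-1 = u by rewrite expgS expg1 -{1}abu mulgKV.
apply: J_inj; rewrite codeJM ?groupM // codeJV; last exact: expg_closedV.
by rewrite Ju invUg !invg_set1 mulgU !mulg_set1 mulgK (mulgC a) mulgK setUC.
Qed.

Lemma card_codeJ_neq2 u : #|J u| <> 2.
Proof.
move=> /eqP/cards2P[a [b [neq_ab Ju]]].
have /[dup] Ja : a \in J u by rewrite Ju set21.
rewrite mem_codeJ => /andP[Sua Ca].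
have /setIP[_ Cb] : b \in J u by rewrite Ju set22.
pose k := b^-1 * a.
have Ck : k \in C by rewrite groupM ?groupV.
have k_neq1 : k != 1 by rewrite -eq_mulVg1 eq_sym.
have sqr_ua : (u^-1 * a) ^+ 2 = k.
  rewrite expgMn; last exact: mulgC.
  by rewrite expgVn (codeJ_set2_sqr Ju) invMg -mulgA mulKg.
have Jka : k * a \in J u.
  rewrite mem_codeJ groupM // andbT mulgA (mulgC _ k) -mulgA -sqr_ua -expgSr.
  exact: SX.
have ka_b : k * a = b.
  move: Jka; rewrite Ju !inE -{2}[a]mul1g (inj_eq (mulIg a)).
  by rewrite (negbTE k_neq1) => /eqP.
have kb_a : k * b = a by rewrite mulgC mulKVg.
have k_fix_u : k * u = 1 * u.
  by apply: J_inj; rewrite mul1g codeJM // Ju mulgU !mulg_set1 ka_b kb_a setUC.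
by move/mulIg/eqP: k_fix_u; apply/negP.
Qed.

End ExpgClosed.

Section CyclicUnion.
Variables (I : finType) (g : I -> gT).
Hypothesis defS : S = \bigcup_i <[g i]>.
Hypothesis g_tI : forall i j, i != j -> <[g i]> :&: <[g j]> = 1.
Hypothesis g_sqr_neq1 : forall i, g i ^+ 2 != 1.
Hypothesis J_inj : injective J.

Lemma codeJ_eq1 u : J u = [set 1] -> u = 1.
Proof.
move=> Ju; apply/eqP; apply: contraT => u_neq1.
have SX : expg_closed S by rewrite defS; exact: bigcup_expg_closed.
have SV := expg_closedV SX.
have uV : u^-1 = u by apply: J_inj; rewrite codeJV // Ju invg_set1 invg1.
have /bigcupP[i _ /[dup] g_u /cycleP[p uE]] : u \in \bigcup_i <[g i]>.
  by rewrite -defS -mem1_codeJ // Ju set11.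
have neq_gu : g i != u.
  apply: contraNneq (g_sqr_neq1 i) => ->.
  by rewrite expgS expg1 -{1}uV mulVg.
have J1 : 1 \in J (g i).
  by rewrite mem1_codeJ // defS; apply/bigcupP; exists i; rewrite ?cycle_id.
have /properP[_ [c Jc]] : [set 1] \proper J (g i).
  by rewrite properEneq sub1set J1 andbT -Ju (inj_eq J_inj) eq_sym.
have cp : c ^+ p = 1 by apply/set1P; rewrite -Ju uE codeJX.
move: (Jc); rewrite mem_codeJ => /andP[+ Cc].
rewrite defS => /bigcupP[j _ gc_j].
have gcX : ((g i)^-1 * c) ^+ p = u.
  by rewrite expgMn; [rewrite expgVn -uE cp mulg1 | exact: mulgC].
have eq_ij : i = j.
  apply: contraNeq u_neq1 => /g_tI tI.
  by rewrite -in_set1 -[[set 1]]tI inE g_u -gcX groupX.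
have c_axis : c \in <[g i]>.
  by rewrite -(groupMl c (groupVr (cycle_id (g i)))) {2}eq_ij.
case/negP; rewrite -Ju mem_codeJ Cc andbT defS.
by apply/bigcupP; exists i; rewrite // groupM ?groupV.
Qed.

Lemma codeJ_eq_set1 u a : J u = [set a] -> u = a.
Proof.
move=> Ju; have /setIP[_ Ca] : a \in J u by rewrite Ju set11.
apply: (mulgI a^-1); rewrite mulVg; apply: codeJ_eq1.
by rewrite codeJM ?groupV // Ju mulg_set1 mulVg.
Qed.

End CyclicUnion.

End CayleyCode.

Section HammingAxes.
Variables (n : nat) (m : 'I_n -> nat).
Implicit Types (u v w : hammingV m) (i j : 'I_n).

Lemma hamming1 i : (1 : hammingV m) i = 0%R.
Proof. by rewrite ffunE. Qed.

Lemma hamming_inv u i : u^-1 i = (- u i)%R.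
Proof. by rewrite ffunE. Qed.

Lemma hammingX u p i : (u ^+ p) i = (u i *+ p)%R.
Proof.
elim: p => [|p IHp]; first by rewrite expg0 hamming1 mulr0n.
by rewrite expgS hammingM IHp mulrS.
Qed.

Lemma hamming_mulC u v : u * v = v * u.
Proof. by apply/ffunP => i; rewrite !hammingM addrC. Qed.

Definition hamming_delta i : hammingV m := [ffun j => ((j == i)%:R)%R].

Lemma hamming_deltaE i j : hamming_delta i j = ((j == i)%:R)%R.
Proof. by rewrite ffunE. Qed.

Definition hamming_axis i : {group hammingV m} := <[hamming_delta i]>%G.

Lemma hamming_axisP i w :
  reflect (forall j, j != i -> w j = 0%R) (w \in hamming_axis i).
Proof.
apply: (iffP (cycleP _ _)) => [[p ->] j neq_ji | w0].
  by rewrite hammingX hamming_deltaE (negbTE neq_ji) mul0rn.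
exists (w i : nat); apply/ffunP => j; rewrite hammingX hamming_deltaE.
by have [-> | /w0] := eqVneq j i; rewrite ?natr_Zp ?mul0rn.
Qed.

Lemma hamming_axis_tI i j : i != j -> hamming_axis i :&: hamming_axis j = 1.
Proof.
move=> neq_ij; apply/trivgP/subsetP => w.
case/setIP=> /hamming_axisP w_i /hamming_axisP w_j; rewrite inE.
apply/eqP/ffunP => k; rewrite hamming1.
by have [-> | /w_i //] := eqVneq k i; apply: w_j.
Qed.

Lemma hamming_delta_sqr_neq1 i : 2 < m i -> hamming_delta i ^+ 2 != 1.
Proof.
move=> m_gt2; apply/eqP => /ffunP/(_ i).
rewrite hammingX hamming_deltaE eqxx hamming1 => /(congr1 val).
by rewrite [LHS]val_Zp_nat ?modn_small // ltnW.
Qed.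

Lemma closed_nbhd_hamming u : 0 < n ->
  closed_nbhd (@hamming_adj n m) u = u *: \bigcup_i hamming_axis i.
Proof.
move=> n_gt0; apply/setP => v; rewrite mem_lcoset !inE.
have mem_axis i :
    reflect (forall j, j != i -> u j = v j) (u^-1 * v \in hamming_axis i).
  apply: (iffP (hamming_axisP _ _)) => eq_uv j /eq_uv;
    rewrite hammingM hamming_inv.
    by rewrite addrC => /subr0_eq.
  by move->; rewrite addNr.
apply/orP/bigcupP => [[/eqP-> | /cards1P[i diff_uv]] | [i _ /mem_axis eq_uv]].
- by exists (Ordinal n_gt0); rewrite // mulVg group1.
- exists i => //; apply/mem_axis => j; apply: contra_neq_eq => neq_uv.
  by apply/set1P; rewrite -diff_uv inE.
have [eq_uv_i | neq_uv_i] := eqVneq (u i) (v i); [left | right].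
  by apply/eqP/ffunP => j; have [-> // | /eq_uv //] := eqVneq j i.
apply/cards1P; exists i; apply/setP => j; rewrite !inE.
by have [-> // | /eq_uv ->] := eqVneq j i; rewrite ?eqxx.
Qed.

End HammingAxes.

Theorem theorem3p7 (n : nat) (m : 'I_n -> nat) (C : {set hammingV m})
    (hn : 3 <= n) (hm : forall i, 3 <= m i)
    (hC : group_identifying_code C) :
  (forall u : hammingV m, #|codeJ (@hamming_adj n m) C u| <> 2) /\
  (forall u : hammingV m, u \notin C -> 3 <= #|codeJ (@hamming_adj n m) C u|).
Proof.
case: hC => gC [J_neq0 J_inj]; pose G := Group gC.
have nbhdE (u : hammingV m) := closed_nbhd_hamming u (ltnW (ltnW hn)).
have SX := bigcup_expg_closed (A := @hamming_axis n m).
have neq2 := card_codeJ_neq2 (C := G) nbhdE (@hamming_mulC n m) SX J_inj.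
split=> // u notCu.
have neq1 : #|codeJ (@hamming_adj n m) C u| != 1%N.
  apply: contra notCu => /cards1P[a Ju].
  have /setIP[_ Ca] : a \in codeJ (@hamming_adj n m) C u by rewrite Ju set11.
  by rewrite (codeJ_eq_set1 (C := G) nbhdE (@hamming_mulC n m) erefl
    (@hamming_axis_tI n m) (fun i => hamming_delta_sqr_neq1 (hm i)) J_inj Ju).
have := J_neq0 u; have := neq2 u; rewrite -cards_eq0; move: neq1.
by case: #|_| => [|[|[|p]]].
Qed.
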